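(* Let $\mathfrak C:\mathcal Z^*\to\mathcal Z^*$ be a mapping with $\mathfrak C(S)\subseteq S$ for all $S$ and $$\mathfrak C(\mathfrak C(S)\setminus U)=\mathfrak C(S)\setminus U \quad\text{for every } S\in\mathcal Z^* \text{ and every } U\subseteq S .$$ Let $\varepsilon,\delta\ge 0$ and let $A_{\mathrm{un}}$ be an unlearning algorithm with state-of-system $\mathsf I_{A_{\mathrm{un}}}$ such that for all $S\in\mathcal Z^*$, all $U\subseteq S$ and all measurable sets $F$, $$\Pr(\mathsf I_{A_{\mathrm{un}}}(S,U)\in F)\le e^{\varepsilon}\Pr(\mathsf I_{A_{\mathrm{un}}}(S\setminus U,\emptyset)\in F)+\delta,$$ $$\Pr(\mathsf I_{A_{\mathrm{un}}}(S\setminus U,\emptyset)\in F)\le e^{\varepsilon}\Pr(\mathsf I_{A_{\mathrm{un}}}(S,U)\in F)+\delta .$$ Let $A_{\mathrm{CS}}$ be the algorithm that, given a dataset $S$ and unlearning requests $U\subseteq S$, applies $A_{\mathrm{un}}$ to the dataset $\mathfrak C(S)$ with requests $U$, so that its state-of-system is $\mathsf I_{A_{\mathrm{CS}}}(S,U)=\mathsf I_{A_{\mathrm{un}}}(\mathfrak C(S),U)$. Then $A_{\mathrm{CS}}$ is a system-aware-$(\varepsilon,\delta)$-unlearning algorithm with $S'=\mathfrak C(S)$.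
   Context: $\mathcal Z$ is an instance space; datasets are elements of $\mathcal Z^*$. For a learning-unlearning algorithm $A$, the state-of-system is a map $\mathsf I_A:\mathcal Z^*\times\mathcal Z^*\to\Delta(\mathcal I)$ ($\mathcal I$ an arbitrary set of states, $\Delta(\mathcal I)$ the distributions on it); $\mathsf I_A(S,U)$ is the (random) content stored in the system by $A$ after learning on $S$ and processing deletion requests $U$. Requests in $U$ that do not belong to the dataset to which an algorithm is applied are ignored, i.e. $\mathsf I_{A_{\mathrm{un}}}(\mathfrak C(S),U)$ means $\mathsf I_{A_{\mathrm{un}}}(\mathfrak C(S),U\cap\mathfrak C(S))$. Definition (system-aware-$(\varepsilon,\delta)$-unlearning). $A$ is a system-aware-$(\varepsilon,\delta)$-unlearning algorithm if for all $S\in\mathcal Z^*$ there exists $S'\subseteq S$ such that for all $U\subseteq S$ and all measurable sets $F$, $\Pr(\mathsf I_A(S,U)\in F)\le e^{\varepsilon}\Pr(\mathsf I_A(S'\setminus U,\emptyset)\in F)+\delta$ and $\Pr(\mathsf I_A(S'\setminus U,\emptyset)\in F)\le e^{\varepsilon}\Pr(\mathsf I_A(S,U)\in F)+\delta$. ''With $S'=\mathfrak C(S)$'' means these inequalities hold for this choice of $S'$. *)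

(* Defs.v *)
From HB Require Import structures.
From mathcomp Require Import all_boot all_order all_algebra.
From mathcomp Require Import all_classical all_reals all_analysis.

Set Implicit Arguments.
Unset Strict Implicit.
Unset Printing Implicit Defensive.

Import Order.TTheory GRing.Theory Num.Theory.
Local Open Scope ring_scope.

(* Elements of Z^* are finite sequences.  The set-theoretic operations on them
   are membership-based: inclusion is [{subset U <= S}], and difference and
   intersection filter the left operand, keeping its order and repetitions. *)
Definition dataset (Z : eqType) := seq Z.

Definition dataset_diff (Z : eqType) (S U : dataset Z) : dataset Z :=
  [seq z <- S | z \notin U].

Definition dataset_inter (Z : eqType) (U S : dataset Z) : dataset Z :=
  [seq z <- U | z \in S].

(* A learning-unlearning algorithm enters only through the distribution of the
   content it stores after learning on the first argument and processing the
   deletion requests in the second. *)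
Definition state_of_system (Z : eqType) (d : measure_display)
    (I : measurableType d) (R : realType) :=
  dataset Z -> dataset Z -> probability I R.

Definition indistinguishable (d : measure_display) (I : measurableType d)
    (R : realType) (eps delta : R) (P Q : probability I R) : Prop :=
  forall F : set I, measurable F ->
    (P F <= (expR eps)%:E * Q F + delta%:E)%E /\
    (Q F <= (expR eps)%:E * P F + delta%:E)%E.

Definition unlearns_with (Z : eqType) (d : measure_display)
    (I : measurableType d) (R : realType) (eps delta : R)
    (A : state_of_system Z I R) (S S' : dataset Z) : Prop :=
  {subset S' <= S} /\
  forall U : dataset Z, {subset U <= S} ->
    indistinguishable eps delta (A S U) (A (dataset_diff S' U) [::]).

Definition system_aware_unlearning (Z : eqType) (d : measure_display)
    (I : measurableType d) (R : realType) (eps delta : R)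
    (A : state_of_system Z I R) : Prop :=
  forall S : dataset Z, exists S' : dataset Z, unlearns_with eps delta A S S'.

(* The state-of-system of A_CS: requests outside the core set [C S], the dataset
   to which A_un is applied, are ignored. *)
Definition core_set_state (Z : eqType) (d : measure_display)
    (I : measurableType d) (R : realType) (C : dataset Z -> dataset Z)
    (A : state_of_system Z I R) : state_of_system Z I R :=
  fun S U => A (C S) (dataset_inter U (C S)).

(* Main.v *)
(* A_un only sees the requests U lying in C S, and removing these from C S is
   the same as removing all of U.  Its guarantee on C S therefore compares
   A_CS (S, U) with A_un (C S minus U, empty); stability of C identifies the
   latter with A_CS (C S minus U, empty). *)
Require Import Defs.
From HB Require Import structures.
From mathcomp Require Import all_boot all_order all_algebra.
From mathcomp Require Import all_classical all_reals all_analysis.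

Set Implicit Arguments.
Unset Strict Implicit.
Unset Printing Implicit Defensive.

Import Order.TTheory GRing.Theory Num.Theory.
Local Open Scope ring_scope.

Lemma dataset_interSr (Z : eqType) (U S : dataset Z) :
  {subset dataset_inter U S <= S}.
Proof. by move=> z; rewrite mem_filter => /andP[]. Qed.

(** The filter tests only elements of [S], and on these membership in [U] and in [dataset_inter U S]
    agree. *)
Lemma dataset_diff_inter (Z : eqType) (S U : dataset Z) :
  dataset_diff S (dataset_inter U S) = dataset_diff S U.
Proof. by apply: eq_in_filter => z zS; rewrite mem_filter zS. Qed.

Theorem theorem3p1 (R : realType) (Z : eqType)
    (d : measure_display) (I : measurableType d)
    (C : dataset Z -> dataset Z)
    (C_sub : forall S : dataset Z, {subset C S <= S})
    (C_stable : forall S U : dataset Z, {subset U <= S} ->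
      C (dataset_diff (C S) U) = dataset_diff (C S) U)
    (eps delta : R) (eps_ge0 : 0 <= eps) (delta_ge0 : 0 <= delta)
    (A_un : state_of_system Z I R)
    (A_un_unlearns : forall S U : dataset Z, {subset U <= S} ->
      indistinguishable eps delta (A_un S U) (A_un (dataset_diff S U) [::])) :
  system_aware_unlearning eps delta (core_set_state C A_un) /\
  forall S : dataset Z, unlearns_with eps delta (core_set_state C A_un) S (C S).
Proof.
have CS_unlearns S : unlearns_with eps delta (core_set_state C A_un) S (C S).
  split=> [|U US]; first exact: C_sub.
  (* [U] lies in [S] but perhaps not in [C S], so the backward rewrite restores the restricted
     requests, to which [A_un_unlearns] at [C S] applies. On the right, [dataset_inter [::] _]
     computes to [[::]]. *)
  rewrite /core_set_state C_stable // -(dataset_diff_inter (C S) U).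
  exact/A_un_unlearns/dataset_interSr.
by split=> // S; exists (C S).
Qed.
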